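(* Let $F_n$ be the friendship graph with $n \geq 2$. Then $$\tilde{\gamma}_{c}(M(F_n)) = n+1.$$
   Context: All graphs are non-empty, finite, undirected and simple. The friendship graph $F_n$ has vertex set $\{v_0, v_1, \dots, v_{2n}\}$ and edge set $\{v_0v_1, v_0v_2, \dots, v_0v_{2n}\} \cup \{v_1v_2, v_3v_4, \dots, v_{2n-1}v_{2n}\}$. A dominating set of a graph $H$ is a set $S \subseteq V(H)$ such that $N_H[v] \cap S \neq \emptyset$ for every $v \in V(H)$, where $N_H[v]$ is the closed neighborhood of $v$. A dominating set $S$ of $H$ is an outer-connected dominating set if the graph $H - S$ (obtained by deleting the vertices in $S$) is connected. The outer-connected domination number $\tilde{\gamma}_c(H)$ is the minimum cardinality of an outer-connected dominating set of $H$. The middle graph $M(G)$ of a graph $G$ is the graph with vertex set $V(G) \cup E(G)$ (disjoint union), in which two vertices $x,y$ are adjacent if and only if either $x,y \in E(G)$ are distinct edges sharing an endpoint in $G$, or one of them is a vertex of $G$ and the other is an edge of $G$ incident with it. *)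

(* Defs.v *)
From HB Require Import structures.
From mathcomp Require Import all_boot.

Set Implicit Arguments.
Unset Strict Implicit.
Unset Printing Implicit Defensive.

Record sgraph := SGraph {
  vertex :> finType;
  adj : rel vertex;
  adj_sym : symmetric adj;
  adj_irr : irreflexive adj }.

Definition edges (G : sgraph) : {set {set G}} :=
  [set [set p.1; p.2] | p : G * G & adj p.1 p.2].

Definition edge (G : sgraph) : finType := {A : {set G} | A \in edges G}.

Section Delete.
Variables (H : sgraph) (S : {set H}).

Definition del_vertex : finType := {x : H | x \notin S}.
Definition del_adj : rel del_vertex := fun x y => adj (val x) (val y).

Lemma del_adj_sym : symmetric del_adj.
Proof. by move=> x y; apply: adj_sym. Qed.

Lemma del_adj_irr : irreflexive del_adj.
Proof. by move=> x; apply: adj_irr. Qed.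

Definition delete : sgraph := SGraph del_adj_sym del_adj_irr.
End Delete.

(* Graphs are non-empty by convention, so the null graph (obtained by deleting
   every vertex) does not count as connected. *)
Definition connected (H : sgraph) : bool :=
  (0 < #|H|) && [forall x : H, forall y : H, connect (@adj H) x y].

Definition closed_nbhd (H : sgraph) (v : H) : {set H} :=
  [set u | (u == v) || adj v u].

Definition dominating (H : sgraph) (S : {set H}) : bool :=
  [forall v : H, closed_nbhd v :&: S != set0].

Definition outer_connected_dominating (H : sgraph) (S : {set H}) : bool :=
  dominating S && connected (delete S).

(* The default [set: H] is only returned when H has no outer-connected
   dominating set; see the two lemmas below. *)
Definition ocd_number (H : sgraph) : nat :=
  #|[arg min_(S < [set: H] | outer_connected_dominating S) #|S| ]|.

Lemma ocd_number_attained (H : sgraph) (S : {set H}) :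
  outer_connected_dominating S ->
  exists2 S0 : {set H}, outer_connected_dominating S0 & #|S0| = ocd_number H.
Proof.
move=> ocdS; rewrite /ocd_number /arg_min /extremum; case: pickP => [S0 | no_min].
  by case/andP=> ocdS0 _; exists S0.
case: (arg_minnP (fun A : {set H} => #|A|) ocdS) => S1 ocdS1 minS1.
have /= := no_min S1; rewrite ocdS1 /= => /negP[].
by apply/forallP=> A; apply/implyP; apply: minS1.
Qed.

Lemma ocd_number_le (H : sgraph) (S : {set H}) :
  outer_connected_dominating S -> ocd_number H <= #|S|.
Proof.
move=> ocdS; rewrite /ocd_number /arg_min /extremum; case: pickP => [S0 | no_min].
  by case/andP=> _ /forallP/(_ S)/implyP; apply.
case: (arg_minnP (fun A : {set H} => #|A|) ocdS) => S1 ocdS1 minS1.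
have /= := no_min S1; rewrite ocdS1 /= => /negP[].
by apply/forallP=> A; apply/implyP; apply: minS1.
Qed.

Section Middle.
Variable G : sgraph.

Definition middle_vertex : finType := (G + edge G)%type.

Definition middle_adj : rel middle_vertex := fun x y =>
  match x, y with
  | inl _, inl _ => false
  | inl v, inr e => v \in val e
  | inr e, inl v => v \in val e
  | inr e, inr f => (e != f) && (val e :&: val f != set0)
  end.

Lemma middle_adj_sym : symmetric middle_adj.
Proof. by case=> [x|e] [y|f] //=; rewrite eq_sym setIC. Qed.

Lemma middle_adj_irr : irreflexive middle_adj.
Proof. by case=> [x|e] //=; rewrite eqxx. Qed.

Definition middle_graph : sgraph := SGraph middle_adj_sym middle_adj_irr.
End Middle.

Section Friendship.
Variable n : nat.

Definition friend_arc (i j : nat) : bool :=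
  ((i == 0) && (0 < j)) || (odd i && (j == i.+1)).

Definition friendship_adj : rel 'I_(2 * n).+1 := fun i j =>
  friend_arc i j || friend_arc j i.

Lemma friendship_adj_sym : symmetric friendship_adj.
Proof. by move=> i j; apply: orbC. Qed.

Lemma friendship_adj_irr : irreflexive friendship_adj.
Proof.
move=> i; rewrite /friendship_adj orbb /friend_arc lt0n andbN.
by rewrite (ltn_eqF (ltnSn i)) andbF.
Qed.

Definition friendship : sgraph := SGraph friendship_adj_sym friendship_adj_irr.
End Friendship.

(* Main.v *)
Require Import Defs.
From mathcomp Require Import all_boot zify.

(** Lower bound. In a middle graph a vertex [v] of [G] is only adjacent to the
    edges incident with it, so each member of a dominating set dominates at
    most two vertices of [G]: itself if it is a vertex, its two ends if it is
    an edge. Hence [#|G| <= 2 * #|S|] ([leq_card_dominating_middle]), and since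
    the friendship graph has [2n + 1] vertices, [#|S| >= n + 1].

    Upper bound. Take the hub together with the [n] edges that avoid it, the
    outer sides of the triangles. What is left of the middle graph is the clique
    formed by the spokes, with every rim vertex hanging from its own spoke:
    this is connected. The rim vertices are dominated by the outer sides and
    the spokes by the hub. Connectedness holds around any universal
    vertex ([hub_cover_outer_connected]), and domination needs moreover that
    every rim vertex has a rim neighbour ([hub_cover_dominating]). The triangles
    give the size of the set: an edge avoiding the hub is the outer side of one
    of [n] triangles ([card_friendship_rim_edges]). *)

Set Implicit Arguments.
Unset Strict Implicit.
Unset Printing Implicit Defensive.

Section MiddleGraph.
Variable G : sgraph.

Lemma edge_of_adj (u v : G) : adj u v -> {e : edge G | val e = [set u; v]}.
Proof.
move=> uv; have eP : [set u; v] \in edges G.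
  by apply/imsetP; exists (u, v) => //; rewrite inE.
by exists (exist (fun A => A \in edges G) _ eP).
Qed.

Lemma edge_ends (e : edge G) : exists u v : G, adj u v /\ val e = [set u; v].
Proof.
by have /imsetP[[u v]] := valP e; rewrite inE => uv ->; exists u, v.
Qed.

(** The vertices of [G] in the closed neighbourhood of [x] in the middle
    graph. *)
Definition dominated_vertices (x : middle_graph G) : {set G} :=
  match x with inl v => [set v] | inr e => val e end.

Lemma card_dominated_vertices (x : middle_graph G) :
  #|dominated_vertices x| <= 2.
Proof.
case: x => [v|e] /=; first by rewrite cards1.
have [u [v [_ ->]]] := edge_ends e.
by rewrite cards2; case: (_ != _).
Qed.

Lemma leq_card_dominating_middle (S : {set middle_graph G}) :
  dominating S -> #|G| <= 2 * #|S|.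
Proof.
move=> /forallP domS.
have cover : [set: G] \subset \bigcup_(x in S) dominated_vertices x.
  apply/subsetP=> v _; have /set0Pn[x] := domS (inl v : middle_graph G).
  rewrite !inE => /andP[vx xS]; apply/bigcupP; exists x => //.
  by case: x vx {xS} => [w|e] //=; rewrite inE orbF eq_sym => /eqP[->].
rewrite -cardsT (leq_trans (subset_leq_card cover)) // mulnC -sum_nat_const.
elim/big_ind2: _ => [|m A k B Am Bk|x _]; first by rewrite cards0.
  exact: leq_trans (leq_card_setU A B) (leq_add Am Bk).
exact: card_dominated_vertices.
Qed.

Definition hub_cover (u : G) : {set middle_graph G} :=
  (inl u : middle_graph G)
    |: [set (inr e : middle_graph G) | e in [set e : edge G | u \notin val e]].

Lemma hub_cover_inl (u v : G) :
  ((inl v : middle_graph G) \in hub_cover u) = (v == u).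
Proof.
rewrite !inE; set b := (X in _ || X).
suff -> : b = false by rewrite orbF.
by apply/imsetP=> -[].
Qed.

Lemma hub_cover_inr (u : G) (e : edge G) :
  ((inr e : middle_graph G) \in hub_cover u) = (u \notin val e).
Proof.
rewrite !inE /= mem_imset ?inE //.
by move=> ? ? [].
Qed.

Section Hub.
Variable u : G.
Hypothesis hub_adj : forall v, v != u -> adj u v.

(** By [rim_adj] a vertex other than [u] is an end of some edge in the cover,
    while an edge outside the cover contains [u], which then dominates it. *)
Lemma hub_cover_dominating
    (rim_adj : forall v, v != u -> exists2 w, w != u & adj v w) :
  dominating (hub_cover u).
Proof.
apply/forallP=> x; apply/set0Pn.
have [xS|] := boolP (x \in hub_cover u).
  by exists x; rewrite inE xS inE eqxx.
case: x => [v|e]; rewrite ?hub_cover_inl ?hub_cover_inr.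
  move=> vu; have [w wu vw] := rim_adj v vu; have [e De] := edge_of_adj vw.
  exists (inr e : middle_graph G).
  rewrite inE hub_cover_inr inE /= De !inE eqxx /=.
  by rewrite negb_or eq_sym vu eq_sym wu.
rewrite negbK => ue; exists (inl u : middle_graph G).
by rewrite inE hub_cover_inl eqxx inE /= ue.
Qed.

(** The spokes form a clique and every other remaining vertex is attached to
    one of them. *)
Lemma hub_cover_outer_connected :
  1 < #|G| -> connected (delete (hub_cover u)).
Proof.
move=> G_gt1; set D := delete _.
have in_D (e : edge G) :
    u \in val e -> {x : D | val x = inr e :> middle_vertex G}.
  move=> ue; have eP : (inr e : middle_graph G) \notin hub_cover u.
    by rewrite hub_cover_inr negbK.
  by exists (exist (fun x => x \notin hub_cover u) _ eP).
have spoke v : v != u ->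
    {x : D & {e : edge G | val x = inr e :> middle_vertex G
                         & (u \in val e) && (v \in val e)}}.
  move=> /hub_adj uv; have [e De] := edge_of_adj uv.
  have ends : (u \in val e) && (v \in val e) by rewrite De !inE !eqxx orbT.
  by have [x Dx] := in_D e (proj1 (andP ends)); exists x, e.
have to_spoke (x : D) :
    exists2 y : D, connect (@adj D) x y
    & exists2 e : edge G, val y = inr e :> middle_vertex G & u \in val e.
  case Dx: (val x) (valP x) => [v|e]; rewrite /= ?hub_cover_inl ?hub_cover_inr.
    move=> /spoke[y [e Dy /andP[ue ve]]]; exists y; last by exists e.
    by apply: connect1; rewrite /= /del_adj Dx Dy.
  by rewrite negbK => ue; exists x => //; exists e.
apply/andP; split.
  have [v /spoke[x _]] : exists v, v != u.
    have /card_gt1P[v [w [_ _ vw]]] := G_gt1.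
    by have [<-|vu] := eqVneq v u; [exists w; rewrite eq_sym | exists v].
  by apply/card_gt0P; exists x.
apply/forallP=> x; apply/forallP=> y.
have [x' xx' [e Dx' ue]] := to_spoke x; have [y' yy' [f Dy' uf]] := to_spoke y.
apply: connect_trans xx' _.
rewrite (sym_connect_sym (@adj_sym D)); apply: connect_trans yy' _.
have [fe|fe] := eqVneq f e.
  suff -> : y' = x' by apply: connect0.
  by apply: val_inj; rewrite Dx' Dy' fe.
apply: connect1; rewrite /= /del_adj Dx' Dy' /= fe.
by apply/set0Pn; exists u; rewrite inE uf.
Qed.

End Hub.

End MiddleGraph.

Section FriendshipGraph.
Variable n : nat.

Let hub : friendship n := ord0.

Lemma friendship_hub_adj (v : friendship n) : v != hub -> adj hub v.
Proof.
by move=> v0; rewrite /= /friendship_adj /friend_arc /= lt0n v0.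
Qed.

Lemma friendship_rim_adj (v : friendship n) :
  v != hub -> exists2 w, w != hub & adj v w.
Proof.
case: v => i i_lt; rewrite -val_eqE /= => i_neq0.
pose j := if odd i then i.+1 else i.-1.
have j_lt : j < (2 * n).+1 by rewrite /j; case: ifP => oi; lia.
exists (Ordinal j_lt : friendship n).
  by rewrite -val_eqE /= /j; case: ifP => oi; lia.
rewrite /= /friendship_adj /friend_arc /= /j.
by case: ifP => oi; apply/orP; [left|right]; lia.
Qed.

Lemma card_friendship_rim_edges :
  #|[set e : edge (friendship n) | hub \notin val e]| <= n.
Proof.
pose outer_side (k : 'I_n) : {set friendship n} :=
  [set inord k.*2.+1; inord k.*2.+2].
rewrite -(card_imset _ val_inj) -[leqRHS]card_ord.
apply: leq_trans (leq_imset_card outer_side _); apply: subset_leq_card.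
apply/subsetP=> A /imsetP[e]; rewrite inE => + ->.
have [i [j [ij ->]]] := edge_ends e.
rewrite !inE negb_or -!val_eqE /= => /andP[i0 j0].
(* Up to exchanging its ends, an edge avoiding the hub joins an odd vertex to
   its successor. *)
wlog arc : i j ij i0 j0 / friend_arc i j.
  move=> IH; have := ij; rewrite /= /friendship_adj => /orP[]; first exact: IH.
  by rewrite setUC; apply: IH; rewrite // adj_sym.
have [oi Dj] : odd i /\ j = i.+1 :> nat.
  by move: arc; rewrite /friend_arc => /orP[]; lia.
have k_lt : i./2 < n by have := ltn_ord j; lia.
apply/imsetP; exists (Ordinal k_lt) => //.
have Di : i = i./2.*2.+1 :> nat by lia.
by rewrite /outer_side /= -Di -Dj !inord_val.
Qed.

Lemma card_friendship_hub_cover : #|hub_cover hub| <= n.+1.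
Proof.
rewrite cardsU1 -add1n leq_add ?leq_b1 //.
exact: leq_trans (leq_imset_card _ _) card_friendship_rim_edges.
Qed.

End FriendshipGraph.

Theorem theorem4p13 (n : nat) (hn : 2 <= n) :
  ocd_number (middle_graph (friendship n)) = n + 1.
Proof.
have ocd_cover : outer_connected_dominating (hub_cover (ord0 : friendship n)).
  rewrite /outer_connected_dominating hub_cover_dominating /=.
  - apply: hub_cover_outer_connected; first exact: friendship_hub_adj.
    by rewrite card_ord; lia.
  - exact: friendship_rim_adj.
apply/eqP; rewrite addn1 eqn_leq; apply/andP; split.
  exact: leq_trans (ocd_number_le ocd_cover) (card_friendship_hub_cover n).
have [S /andP[domS _] <-] := ocd_number_attained ocd_cover.
by have := leq_card_dominating_middle domS; rewrite card_ord; lia.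
Qed.
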